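(* Let $X$, $Y$ be topological vector spaces. Let $\tau$ be a vector topology on $X$ coarser than or equal to the weak topology, and let $\mathcal{B}$ be a bornology on $X$ consisting of weakly bounded sets. Then a homogeneous polynomial from $X$ into $Y$ is $\tau$-continuous on $\mathcal{B}$-sets if and only if it is uniformly $\tau$-continuous on $\mathcal{B}$-sets.
   Context: A family $\mathcal{B}$ of subsets of a vector space $X$ is a bornology if: (a) $\mathcal{B}$ covers $X$; (b) $A\in\mathcal{B}$, $D\subset A$ imply $D\in\mathcal{B}$; (c) $A,D\in\mathcal{B}$ imply $A\cup D\in\mathcal{B}$; (d) $A\in\mathcal{B}$ and $\lambda$ a scalar imply $\lambda A\in\mathcal{B}$; (e) $A,D\in\mathcal{B}$ imply $A+D\in\mathcal{B}$. A $k$-homogeneous polynomial $P:X\to Y$ (not assumed continuous) is a map of the form $P(x)=\hat P(x,\ldots,x)$ with $\hat P:X^k\to Y$ symmetric and $k$-linear. A map $f:X\to Y$ is $\tau$-continuous on $\mathcal{B}$-sets if for each $B\in\mathcal{B}$, $x\in B$ and zero neighbourhood $V$ in $Y$ there is a $\tau$-zero neighbourhood $U$ in $X$ with $f(y)-f(x)\in V$ whenever $y\in B$ and $y-x\in U$. It is uniformly $\tau$-continuous on $\mathcal{B}$-sets if for each zero neighbourhood $V$ in $Y$ and each $B\in\mathcal{B}$ there is a $\tau$-zero neighbourhood $U$ in $X$ such that $f(x)-f(y)\in V$ whenever $x,y\in B$ satisfy $x-y\in U$. *)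

(* Defs.v *)
From HB Require Import structures.
From mathcomp Require Import all_boot all_order all_algebra all_fingroup.
From mathcomp Require Import all_classical all_reals all_analysis.
From mathcomp Require Export complex.

Set Implicit Arguments.
Unset Strict Implicit.
Unset Printing Implicit Defensive.

Import Order.TTheory GRing.Theory Num.Theory.
Import numFieldNormedType.Exports.

Local Open Scope classical_set_scope.
Local Open Scope ring_scope.

Definition real_or_complex (R : realType) (K : numFieldType) : Prop :=
  K = (R : numFieldType) \/ K = (R[i] : numFieldType).

(* Several topologies on one vector space [X] are needed at once, so a topology
   is passed as a structure [tau : Topological X] on the fixed carrier [X], as
   [sup_topology] does; the underlying topological space is
   [Topological.Pack tau], and the algebraic operations are always those of
   [X]. *)
Definition topology_nbhs (X : Type) (tau : Topological X) (x : X) :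
    set_system X :=
  nbhs (x : Topological.Pack tau).

Definition coarser (X : Type) (tau sigma : Topological X) : Prop :=
  forall A : set X,
    open (A : set (Topological.Pack tau)) ->
    open (A : set (Topological.Pack sigma)).

(* The axioms of [topologicalLmodType] for the topology [tau]; continuity of
   the opposite follows from that of the scaling. *)
Definition vector_topology (K : numFieldType) (X : lmodType K)
    (tau : Topological X) : Prop :=
  let T := Topological.Pack tau in
  continuous (fun z : T * T => ((z.1 : X) + (z.2 : X)) : T) /\
  continuous (fun z : K^o * T => ((z.1 : K) *: (z.2 : X)) : T).

Definition topological_dual (K : numFieldType) (X : topologicalLmodType K) :
    Type :=
  {f : {linear X -> K^o} | continuous (f : X -> K^o)}.

Definition weak_topology (K : numFieldType) (X : topologicalLmodType K) :
    Topological X :=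
  Topological.on
    (sup_topology (fun f : topological_dual X =>
       Topological.on (initial_topology (sval f : X -> K^o)))).

(* In a numFieldType, [s < t] with [0 < s] forces [t] to be a (positive) real
   scalar, also when [K] is a field of complex numbers. *)
Definition topology_bounded (K : numFieldType) (X : lmodType K)
    (tau : Topological X) (B : set X) : Prop :=
  forall U : set X, topology_nbhs tau 0 U ->
    exists2 s : K, 0 < s &
      forall t : K, s < t -> B `<=` [set t *: u | u in U].

Definition weakly_bounded (K : numFieldType) (X : topologicalLmodType K)
    (B : set X) : Prop :=
  topology_bounded (weak_topology X) B.

Record bornology (K : numFieldType) (X : lmodType K) (B : set_system X) :
    Prop := Bornology {
  bornology_cover : \bigcup_(A in B) A = setT;
  bornology_sub : forall A D : set X, B A -> D `<=` A -> B D;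
  bornologyU : forall A D : set X, B A -> B D -> B (A `|` D);
  bornologyZ : forall (A : set X) (l : K), B A -> B [set l *: a | a in A];
  bornologyD : forall A D : set X,
    B A -> B D -> B [set a + d | a in A & d in D]
}.

Definition multilinear_map (K : numFieldType) (X Y : lmodType K) (k : nat)
    (F : ('I_k -> X) -> Y) : Prop :=
  forall (x : 'I_k -> X) (i : 'I_k),
    linear (fun u : X => F (dfwith x i u)).

Definition symmetric_map (X Y : Type) (k : nat) (F : ('I_k -> X) -> Y) : Prop :=
  forall (s : 'S_k) (x : 'I_k -> X), F (x \o s) = F x.

Definition homogeneous_polynomial (K : numFieldType) (X Y : lmodType K)
    (k : nat) (P : X -> Y) : Prop :=
  exists F : ('I_k -> X) -> Y,
    [/\ symmetric_map F, multilinear_map F & forall x, P x = F (fun=> x)].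

Definition continuous_on_sets (K : numFieldType) (X : lmodType K)
    (Y : topologicalLmodType K) (tau : Topological X) (B : set_system X)
    (f : X -> Y) : Prop :=
  forall A : set X, B A -> forall x : X, A x ->
  forall V : set Y, nbhs (0 : Y) V ->
  exists2 U : set X, topology_nbhs tau 0 U &
    forall y : X, A y -> U (y - x) -> V (f y - f x).

Definition unif_continuous_on_sets (K : numFieldType) (X : lmodType K)
    (Y : topologicalLmodType K) (tau : Topological X) (B : set_system X)
    (f : X -> Y) : Prop :=
  forall V : set Y, nbhs (0 : Y) V -> forall A : set X, B A ->
  exists2 U : set X, topology_nbhs tau 0 U &
    forall x y : X, A x -> A y -> U (x - y) -> V (f x - f y).

(* Main.v *)
Require Import Defs.
From mathcomp Require Import all_boot all_order all_algebra all_fingroup.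
From mathcomp Require Import all_classical all_reals all_analysis.
From mathcomp Require Import lra.

(** Uniform continuity on [B]-sets always implies continuity on them. The
    converse rests on two properties of the members of [B]: they are stable
    under differences, and they are totally bounded for [tau].

    Total boundedness: a zero neighbourhood of [tau] is a weak one, hence it
    contains a finite intersection of sets where a continuous functional is
    small; each functional is bounded on a weakly bounded set, and bounded sets
    of real or complex scalars are totally bounded
    ([weakly_bounded_totally_bounded]).

    Let [F] be the symmetric [k]-linear map with [P x = F (x, ..., x)]. The
    difference [P x - P y] telescopes into [k] values of [F] that have [x - y]
    in one coordinate and [x] or [y] in each of the others. So it suffices to
    see that [F] is small when one coordinate is small in a [B]-set and the
    others just stay in that set. More generally, [small_on S T] lets the
    coordinates in [S] be small, those in [T] range over a [B]-set, and keeps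
    the others fixed.

    When [T] is empty ([small_on_set0]), the polarization formula writes
    [F x] as a linear combination of values of [P] at sums of coordinates, and
    continuity of [P] at the finitely many points obtained by replacing the
    small coordinates by zero gives the claim.

    In general ([small_on_bounded]), the proof is by induction on the size of
    [T]. For [j] in [T], the claim for [j] moved to [S] gives a neighbourhood
    [U0]. Total boundedness then provides finitely many points [a] such that
    each [x j] differs from one of them by an element of [U0]. Splitting
    [x j = (x j - a) + a] splits [F x] in two: the first term is small by the
    choice of [U0], and for the second one coordinate [j] is fixed to one of
    finitely many values, so that the claim for [T] without [j] applies. This
    order of choices is what makes the argument work with [B]-sets that are
    totally bounded but not compact: [U0] is chosen before the points [a], and
    does not depend on them. *)

Set Implicit Arguments.
Unset Strict Implicit.
Unset Printing Implicit Defensive.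

Import Order.TTheory GRing.Theory Num.Theory.
Import numFieldNormedType.Exports.

Local Open Scope classical_set_scope.
Local Open Scope ring_scope.

(** * Multilinear maps and the polarization formula *)

Lemma dfwith_id (I : eqType) (T : I -> Type) (x : forall i, T i) (i : I) :
  dfwith x i (x i) = x.
Proof. by apply: functional_extensionality_dep => j; case: dfwithP. Qed.

Section Multilinear.
Variables (K : numFieldType) (X Y : lmodType K) (k : nat).
Variables (F : ('I_k -> X) -> Y) (F_lin : multilinear_map F).
Implicit Types (x : 'I_k -> X) (i : 'I_k).

Lemma multilinearD x i u v :
  F (dfwith x i (u + v)) = F (dfwith x i u) + F (dfwith x i v).
Proof. by have := F_lin x i 1 u v; rewrite !scale1r. Qed.

Lemma multilinear0 x i : x i = 0 -> F x = 0.
Proof.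
move=> xi0; have := F_lin x i (-1) 0 0.
by rewrite scaler0 addr0 scaleN1r addNr -{1}xi0 dfwith_id.
Qed.

Lemma multilinearB x i u v :
  F (dfwith x i (u - v)) = F (dfwith x i u) - F (dfwith x i v).
Proof.
by rewrite addrC [RHS]addrC -scaleN1r -[- F _]scaleN1r; exact: F_lin.
Qed.

Lemma multilinear_sum x i (J : finType) (Q : pred J) (z : J -> X) :
  F (dfwith x i (\sum_(j | Q j) z j)) = \sum_(j | Q j) F (dfwith x i (z j)).
Proof.
elim/big_rec2: _ => [|j y1 y2 _ <-]; last exact: multilinearD.
by apply: (@multilinear0 _ i); rewrite dfwithin.
Qed.

Lemma multilinear_expand (Q : pred 'I_k) x :
  F (fun=> \sum_(j | Q j) x j) =
  \sum_(f : {ffun 'I_k -> 'I_k} | [forall i, Q (f i)]) F (x \o f).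
Proof.
pose s := \sum_(j | Q j) x j.
pose mix (r : seq 'I_k) (f : {ffun 'I_k -> 'I_k}) : 'I_k -> X :=
  fun i => if i \in r then x (f i) else s.
(* The coordinates in [r] are expanded and the others keep the whole sum [s];
   pinning the index function to the identity on the latter leaves one index
   function for each choice on [r]. *)
suff expand (r : seq 'I_k) : uniq r -> F (fun=> s) =
    \sum_(f : {ffun 'I_k -> 'I_k} |
        [forall i, if i \in r then Q (f i) else f i == i]) F (mix r f).
  rewrite /s (expand _ (enum_uniq 'I_k)); apply: eq_big => [f|f _].
    by apply: eq_forallb => i; rewrite mem_enum.
  by congr F; apply/funext => i; rewrite /mix mem_enum.
elim: r => [_|i r IHr /= /andP[nri ur]].
  rewrite (big_pred1 (finfun id)) => [|f /=]; first by congr F; apply/funext.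
  apply/forallP/eqP => [Hf|-> i]; last by rewrite ffunE.
  by apply/ffunP => i; rewrite ffunE; apply/eqP/Hf.
pose seti j (f : {ffun 'I_k -> 'I_k}) := [ffun l => if l == i then j else f l].
(* On the right, sort the index functions by their value at [i]; both sides
   become sums over the index functions that are pinned at [i]. *)
rewrite (IHr ur).
rewrite [RHS](partition_big (fun f : {ffun _} => f i) Q) /=; last first.
  by move=> f /forallP/(_ i); rewrite inE eqxx.
under [RHS]eq_bigr => j Qj.
  rewrite (reindex_onto (seti j) (seti i)) => [|f /andP[_ /eqP fi]]; last first.
    by apply/ffunP => l; rewrite !ffunE; case: eqP => // ->.
  over.
rewrite [RHS](exchange_big_dep (fun f : {ffun 'I_k -> 'I_k} =>
   [forall l, if l \in r then Q (f l) else f l == l])) /=; last first.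
  move=> j f Qj /andP[/andP[/forallP H _] /eqP/ffunP E].
  apply/forallP => l; have := H l; have := E l; rewrite !ffunE inE.
  by case: (eqVneq l i) => // -> <-; rewrite (negbTE nri) eqxx.
apply: eq_bigr => f /forallP Hf.
have -> : mix r f = dfwith (mix r f) i s.
  rewrite -[LHS](@dfwith_id _ (fun=> X) _ i); congr (@dfwith _ (fun=> X)).
  by rewrite /mix (negbTE nri).
rewrite multilinear_sum; apply: eq_big => [j|j Qj].
  apply/idP/idP => [Qj|/andP[]//]; rewrite Qj ffunE !eqxx andbT /=.
  apply/andP; split.
    by apply/forallP => l; rewrite ffunE inE; case: (eqVneq l i) => //= _.
  apply/eqP/ffunP => l; rewrite !ffunE; case: eqP => // ->.
  by have := Hf i; rewrite (negbTE nri) => /eqP.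
congr F; apply/funext => l; rewrite /mix ffunE inE.
case: (eqVneq l i) => [->|lni]; first by rewrite dfwithin.
by rewrite dfwithout ?(eq_sym i).
Qed.

(** For [j] outside [D], adding or removing [j] is an involution on the
    supersets of [D] that changes the parity of the cardinal. *)
Lemma alternating_sum_supersets (I : finType) (D : {set I}) :
  D != [set: I]%SET -> \sum_(A : {set I} | D \subset A) (-1) ^+ #|A| = 0 :> K.
Proof.
rewrite -finset.subTset => /subsetPn[j _ jD].
pose toggle (A : {set I}) := if j \in A then A :\ j else j |: A.
have toggleK : involutive toggle.
  move=> A; rewrite /toggle; case: (boolP (j \in A)) => jA.
    by rewrite in_setD1 eqxx /= finset.setD1K.
  by rewrite finset.setU11 finset.setU1K.
set S := LHS; suff : S = - S.
  by move/eqP; rewrite -addr_eq0 -mulr2n mulrn_eq0 => /eqP.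
rewrite {1}/S (reindex_inj (inv_inj toggleK)) /= -sumrN; apply: eq_big => A.
  rewrite /toggle; case: ifP => jA; first by rewrite subsetD1 jD andbT.
  by rewrite -(finset.setU1K (negbT jA)) subsetD1 jD andbT finset.setU1K // jA.
rewrite /toggle; case: (boolP (j \in A)) => jA _.
  by rewrite [in RHS](cardsD1 j) jA exprS mulN1r opprK.
by rewrite cardsU1 jA exprS mulN1r.
Qed.

(** After expansion, an index function [f] occurs in the terms of all [A] that
    contain its image. The signs of these cancel unless [f] is onto, that is a
    permutation, and by symmetry each of the [k!] permutations contributes
    [F x]. *)
Lemma polarization x : symmetric_map F ->
  \sum_(A : {set 'I_k}) (-1) ^+ #|A| *: F (fun=> \sum_(j in A) x j) =
  ((-1) ^+ k * k`!%:R : K) *: F x.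
Proof.
move=> F_sym; under eq_bigr do rewrite multilinear_expand scaler_sumr.
rewrite (exchange_big_dep xpredT) //=.
transitivity (\sum_(f : {ffun 'I_k -> 'I_k} | injectiveb f)
    (-1) ^+ k *: F x); last first.
  rewrite sumr_const mulrC -scalerA scaler_nat; congr (_ *+ _).
  by have := card_inj_ffuns 'I_k 'I_k; rewrite card_ord ffactnn cardsE.
rewrite [RHS]big_mkcond /=; apply: eq_bigr => f _.
rewrite -scaler_suml.
have -> : \sum_(A : {set 'I_k} | [forall i, f i \in A]) (-1) ^+ #|A| =
    \sum_(A : {set 'I_k} | (f @: [set: 'I_k])%SET \subset A) (-1) ^+ #|A| :> K.
  apply: eq_bigl => A; apply/forallP/fintype.subsetP.
    by move=> Hf _ /imsetP[i _ ->]; exact: Hf.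
  move=> Hf i.
  by apply: Hf; apply: imset_f; rewrite finset.in_setT.
case: ifP => [/injectiveP f_inj|/negP f_ninj].
  have f_full : (f @: [set: 'I_k] = [set: 'I_k])%SET.
    by apply/eqP; rewrite eqEcard finset.subsetT (card_imset _ f_inj) leqnn.
  rewrite f_full (big_pred1 [set: 'I_k]%SET) => [|A]; last first.
    by rewrite finset.subTset.
  rewrite cardsT card_ord -(F_sym (perm f_inj) x) /=.
  by congr (_ *: F _); apply/funext => i /=; rewrite permE.
rewrite alternating_sum_supersets ?scale0r //.
apply/negP => /eqP f_full; apply: f_ninj; apply/injectiveP => i j.
have /imset_injP f_inj : #|(f @: [set: 'I_k])%SET| == #|[set: 'I_k]%SET|.
  by rewrite f_full.
exact: f_inj.
Qed.

End Multilinear.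

(** * Filters of zero neighbourhoods and bornologies *)

Lemma size_index_enum (J : finType) : size (index_enum J) = #|J|.
Proof. by rewrite [index_enum J]unlock -enumT cardT. Qed.

(** What the proof needs of the zero neighbourhoods of a vector topology: the
    same lemmas then serve [tau], which is not the topology carried by [X], and
    the topology of [Y]. *)
Record additive_filter (V : zmodType) (N : set_system V) : Prop := {
  additive_filter_filter : Filter N;
  additive_filter0 : forall U, N U -> U 0;
  additive_filterD : forall U, N U ->
    exists2 W, N W & forall a b, W a -> W b -> U (a + b)
}.

(** Halve the neighbourhood [n] times. *)
Lemma additive_filter_sum (V : zmodType) (N : set_system V) (n : nat)
    (U : set V) : additive_filter N -> N U ->
  exists2 W, N W & forall (I : Type) (r : seq I) (Q : pred I) (f : I -> V),
    (size r <= n)%N -> (forall i, Q i -> W (f i)) ->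
    U (\sum_(i <- r | Q i) f i).
Proof.
move=> Nadd; have := additive_filter_filter Nadd => NF.
elim: n U => [|n IHn] U NU.
  exists U => // I [|//] Q f _ _; rewrite big_nil.
  exact: additive_filter0 Nadd _ NU.
have [W NW WU] := additive_filterD Nadd NU.
have [W' NW' W'W] := IHn _ NW.
exists (W `&` W'); first exact: filterI.
move=> I [|i r] Q f /= rn fW.
  by rewrite big_nil; exact: additive_filter0 Nadd _ NU.
have Wr : W (\sum_(j <- r | Q j) f j) by apply: W'W => // j /fW[].
rewrite big_cons; case: ifP => Qi; first by apply: WU => //; exact: (fW _ Qi).1.
by rewrite -[X in U X]add0r; apply: WU => //; exact: additive_filter0 Nadd _ NW.
Qed.

Lemma nbhs_additive_filter (V : zmodType) (tau : Topological V) :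
  let T := Topological.Pack tau in
  continuous (fun z : T * T => ((z.1 : V) + (z.2 : V)) : T) ->
  additive_filter (topology_nbhs tau 0).
Proof.
move=> T addC; split.
- exact: (nbhs_filter (0 : T)).
- by move=> U; exact: (@nbhs_singleton T).
- move=> U NU; have := addC (0 : V, 0 : V) U; rewrite /= addr0 => /(_ NU).
  move=> [[W1 W2] /= [NW1 NW2] WU].
  exists (W1 `&` W2); first exact: (@filterI _ _ (nbhs_filter (0 : T))).
  by move=> a b [W1a _] [_ W2b]; exact: (WU (a, b)).
Qed.

Lemma nbhs0_scale (K : numFieldType) (Y : topologicalLmodType K) (c : K)
    (V : set Y) :
  nbhs (0 : Y) V -> nbhs (0 : Y) [set y | V (c *: y)].
Proof.
move=> NV; have := @scale_continuous K Y (c, 0) V.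
rewrite /= scaler0 => /(_ NV).
move=> [[W1 W2] /= [NW1 NW2] WV].
apply: filterS NW2 => y W2y; apply: (WV (c, y)); split => //=.
exact: nbhs_singleton NW1.
Qed.

(** Finite partitions of [A] into pieces of small diameter, given as the fibres
    of a map to a finite type: they are closed under intersection, need no
    choice of centres, and pull back along linear maps. *)
Definition totally_bounded (V : zmodType) (N : set_system V) (A : set V) :
    Prop :=
  forall U, N U -> exists (J : finType) (g : V -> J),
    forall x y, A x -> A y -> g x = g y -> U (x - y).

Section BornologyTheory.
Variables (K : numFieldType) (X : lmodType K) (B : set_system X).
Hypothesis B_bor : bornology B.

Lemma bornology1 (x : X) : B [set x].
Proof.
have : (\bigcup_(A in B) A) x by rewrite (bornology_cover B_bor).
by move=> [A BA Ax]; apply: (bornology_sub B_bor BA) => _ ->.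
Qed.

Lemma bornologyB (C : set X) : B C ->
  exists2 D, B D & C `<=` D /\ (forall x y, C x -> C y -> D (x - y)).
Proof.
move=> BC; exists (C `|`
  [set a + d | a in C & d in [set (-1 : K) *: a | a in C]]).
  apply: (bornologyU B_bor BC); apply: (bornologyD B_bor BC).
  exact: (bornologyZ B_bor).
split=> [x Cx|x y Cx Cy]; first by left.
by right; exists x => //; exists (- y) => //; exists y; rewrite ?scaleN1r.
Qed.

Lemma bornology_sum (C : set X) (n : nat) : B C ->
  exists2 D, B D & forall (I : Type) (r : seq I) (Q : pred I) (f : I -> X),
    (size r <= n)%N -> (forall i, Q i -> C (f i)) ->
    D (\sum_(i <- r | Q i) f i).
Proof.
move=> BC; elim: n => [|n [D BD HD]].
  exists [set 0]; first exact: bornology1.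
  by move=> I [|//] Q f _ _; rewrite big_nil.
exists ([set c + d | c in C `|` [set 0] & d in D]).
  apply: (bornologyD B_bor) => //.
  by apply: (bornologyU B_bor BC); exact: bornology1.
move=> I [|i r] Q f /= rn fC.
  rewrite big_nil; exists 0; first by right.
  exists 0; last by rewrite addr0.
  by have := HD I [::] Q f erefl fC; rewrite big_nil.
have Dr := HD I r Q f rn fC.
rewrite big_cons; case: ifP => Qi.
  by exists (f i); [left; exact: fC|exists (\sum_(j <- r | Q j) f j)].
exists 0; first by right.
by exists (\sum_(j <- r | Q j) f j); rewrite ?add0r.
Qed.

End BornologyTheory.

(** * Multilinear maps with one small coordinate *)

Section SmallMultilinear.
Variables (K : numFieldType) (X Y : lmodType K).
Variables (N : set_system X) (M : set_system Y) (B : set_system X).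
Hypotheses (N_add : additive_filter N) (M_add : additive_filter M).
Hypothesis M_scale : forall (c : K) (V : set Y), M V -> M [set y | V (c *: y)].
Hypotheses (B_bor : bornology B).
Hypothesis B_tb : forall A, B A -> totally_bounded N A.
Variables (k : nat) (F : ('I_k -> X) -> Y).
Hypotheses (F_sym : symmetric_map F) (F_lin : multilinear_map F).
Hypothesis F_cont : forall A, B A -> forall p, A p -> forall V, M V ->
  exists2 U, N U &
    forall y, A y -> U (y - p) -> V (F (fun=> y) - F (fun=> p)).

#[local] Instance N_filter : Filter N := additive_filter_filter N_add.
#[local] Instance M_filter : Filter M := additive_filter_filter M_add.

(** Outside [S] and [T] the coordinates are those of [w], so that for a nonempty
    [S] and an empty [T] this is continuity at zero of a section of [F] on
    [B]-sets. *)
Definition small_on (S T : {set 'I_k}) : Prop :=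
  forall (w : 'I_k -> X) (C : set X) (V : set Y), B C -> M V ->
  exists2 U, N U & forall x : 'I_k -> X,
    (forall i, i \in S -> C (x i) /\ U (x i)) ->
    (forall i, i \in T -> C (x i)) ->
    (forall i, i \notin S :|: T -> x i = w i) ->
    V (F x).

Lemma filter_all_fin (J : finType) (P : J -> set X -> Prop) :
  (forall j U U', U `<=` U' -> P j U' -> P j U) ->
  (forall j, exists2 U, N U & P j U) -> exists2 U, N U & forall j, P j U.
Proof.
move=> Psub NP.
have /choice[U_ HU] : forall j, exists U, N U /\ P j U.
  by move=> j; have [U NU PU] := NP j; exists U.
exists [set x | forall j, U_ j x].
  by apply: filter_forall => j; exact: (HU j).1.
by move=> j; apply: Psub (HU j).2 => x; apply.
Qed.

(** Compare [x] with the vector [x0] obtained by putting zero in the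
    coordinates of [S], at which [F] vanishes: in the polarization formulas for
    [x] and [x0], the arguments of the polynomial differ by small elements of a
    [B]-set. *)
Lemma small_on_set0 (S : {set 'I_k}) (s : 'I_k) :
  s \in S -> small_on S finset.set0.
Proof.
move=> sS w C V BC MV.
pose c : K := (-1) ^+ k * k`!%:R.
have c0 : c != 0 by rewrite mulf_neq0 ?signr_eq0 // pnatr_eq0 -lt0n fact_gt0.
have [W MW WV] := additive_filter_sum #|{set 'I_k}| M_add (M_scale c^-1 MV).
have [D BD CD] := bornology_sum B_bor k BC.
pose p (A : {set 'I_k}) : X := \sum_(i in A | i \notin S) w i.
have [U NU HU] : exists2 U, N U & forall (A : {set 'I_k}) (y : X), D y -> U y ->
    W ((-1) ^+ #|A| *: (F (fun=> p A + y) - F (fun=> p A))).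
  apply: (@filter_all_fin {set 'I_k} (fun A U => forall y : X, D y -> U y ->
    W ((-1) ^+ #|A| *: (F (fun=> p A + y) - F (fun=> p A))))).
    by move=> A U U' UU' HU' y Dy /UU'; exact: HU'.
  move=> A; have BpD : B [set a + d | a in [set p A] & d in D].
    by apply: (bornologyD B_bor) => //; exact: bornology1.
  have D0 : D 0.
    by have := CD void [::] xpredT (fun=> 0); rewrite big_nil; apply=> // -[].
  have pA : [set a + d | a in [set p A] & d in D] (p A).
    by exists (p A) => //; exists 0; rewrite ?addr0.
  have [U NU HU] := F_cont BpD pA (M_scale ((-1) ^+ #|A|) MW).
  exists U => // y Dy Uy; apply: HU; first by exists (p A) => //; exists y.
  by rewrite addrC addKr.
have [U' NU' U'U] := additive_filter_sum k N_add NU.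
exists U' => // x xS _ xw.
pose x0 i : X := if i \in S then 0 else x i.
have Fx0 : F x0 = 0 by apply: (multilinear0 F_lin (i := s)); rewrite /x0 sS.
have pol_x := polarization F_lin x F_sym.
have := polarization F_lin x0 F_sym; rewrite Fx0 scaler0 => pol_0.
rewrite -[F x](scalerK c0) -/c -[c *: _]subr0 -[X in _ - X]pol_0 -pol_x -sumrB.
apply: WV => [|A _]; first by rewrite size_index_enum.
rewrite -scalerBr; set y := \sum_(i in A | i \in S) x i.
have -> : \sum_(i in A) x i = p A + y.
  rewrite (bigID (mem S)) /= addrC; congr (_ + _).
  apply: eq_bigr => i /andP[_ iS].
  by apply: xw; rewrite finset.setU0.
have -> : \sum_(i in A) x0 i = p A.
  rewrite (bigID (mem S)) /= big1 ?add0r => [|i /andP[_]]; last first.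
    by rewrite /x0 => ->.
  apply: eq_bigr => i /andP[_ iS]; rewrite /x0 (negbTE iS).
  by apply: xw; rewrite finset.setU0.
have size_k : (size (index_enum 'I_k) <= k)%N.
  by rewrite size_index_enum card_ord.
by apply: HU; [apply: CD|apply: U'U] => // i /andP[_ /xS[]].
Qed.

(** Induction on the cardinal of [T]: the statements for [j |: S] and [T :\ j],
    and for [S] and [T :\ j] with coordinate [j] fixed, give that for [S] and
    [T]. *)
Lemma small_on_bounded (S T : {set 'I_k}) (s : 'I_k) :
  s \in S -> {in S, forall i, i \notin T} -> small_on S T.
Proof.
move: {2}#|T| (erefl #|T|) => n; elim: n S T s => [|n IHn] S T s.
  by move=> /eqP; rewrite cards_eq0 => /eqP -> sS _; exact: small_on_set0 sS.
move=> cT sS ST w C V BC MV.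
have [j jT] : exists j, j \in T by apply/finset.set0Pn; rewrite -cards_eq0 cT.
have jS : j \notin S by apply/negP => /ST; rewrite jT.
have cTj : #|(T :\ j)%SET| = n by move: cT; rewrite (cardsD1 j) jT => -[].
have [W MW WV] := additive_filterD M_add MV.
have [D BD [CD CCD]] := bornologyB B_bor BC.
have ST' : {in (j |: S)%SET, forall i, i \notin (T :\ j)%SET}.
  by move=> i; rewrite !inE negb_and; case: eqP => //= _; exact: ST.
have jS1 : j \in (j |: S)%SET by rewrite finset.setU11.
have [U0 NU0 HU0] := IHn _ _ _ cTj jS1 ST' w D W BD MW.
(* The neighbourhood [U0] is now fixed; the points [a] below represent the
   [U0]-small pieces of [C], with zero for an empty piece. *)
have [J [g gU0]] := B_tb BC NU0.
have /choice[a Ha] :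
    forall t, exists a, forall x, C x -> g x = t -> C a /\ g a = t.
  move=> t; have [[x [Cx gx]]|nx] := pselect (exists x, C x /\ g x = t).
    by exists x.
  by exists 0 => x Cx gx; case: nx; exists x.
have [U1 NU1 HU1] : exists2 U, N U & forall t, forall x : 'I_k -> X,
    (forall i, i \in S -> C (x i) /\ U (x i)) ->
    (forall i, i \in (T :\ j)%SET -> C (x i)) ->
    (forall i, i \notin (S :|: (T :\ j))%SET -> x i = dfwith w j (a t) i) ->
    W (F x).
  apply: filter_all_fin => [t U U' UU' HU' x xS|t].
    by apply: HU' => i /xS[? /UU'].
  by apply: (IHn _ _ s) => // i /ST; rewrite !inE negb_and orbC => ->.
exists (U0 `&` U1); first exact: filterI.
move=> x xS xT xw; pose b := a (g (x j)).
have Cxj : C (x j) by exact: xT.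
have [Cb gb] := Ha _ _ Cxj erefl.
have -> : F x = F (dfwith x j (x j - b)) + F (dfwith x j b).
  by rewrite -multilinearD // subrK dfwith_id.
apply: WV.
  apply: HU0 => i; rewrite !inE.
  - case: dfwithP => [_|i' ji]; first by split; [exact: CCD|exact: gU0].
    by rewrite eq_sym (negbTE ji) /= => /xS[/CD ? []].
  - case: dfwithP => [|i' ji]; first by rewrite eqxx.
    by move=> /andP[_ /xT /CD].
  - case: dfwithP => [|i' ji]; first by rewrite eqxx.
    rewrite eq_sym (negbTE ji) /= => iST; apply: xw; by rewrite inE.
apply: (HU1 (g (x j))) => i; rewrite ?inE.
- case: dfwithP => [|i' ji]; first by rewrite (negbTE jS).
  by move=> /xS[? []].
- case: dfwithP => [|i' ji]; first by rewrite eqxx.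
  by move=> /andP[_ /xT].
- case: (eqVneq i j) => [->|ij]; first by rewrite !dfwithin.
  by rewrite !dfwithout 1?eq_sym // => iST; apply: xw; rewrite inE.
Qed.

Lemma unif_continuous_multilinear (A : set X) (V : set Y) : B A -> M V ->
  exists2 U, N U & forall x y, A x -> A y -> U (x - y) ->
    V (F (fun=> x) - F (fun=> y)).
Proof.
move=> BA MV; have [W MW WV] := additive_filter_sum k M_add MV.
have [D BD [AD AAD]] := bornologyB B_bor BA.
have [U NU HU] : exists2 U, N U & forall j : 'I_k, forall z : 'I_k -> X,
    (forall i, i \in [set j]%SET -> D (z i) /\ U (z i)) ->
    (forall i, i \in (~: [set j])%SET -> D (z i)) -> W (F z).
  apply: filter_all_fin => [j U U' UU' HU' z zS|j].
    by apply: HU' => i /zS[? /UU'].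
  have jj : j \in [set j]%SET by rewrite inE.
  have ST : {in [set j]%SET, forall i, i \notin (~: [set j])%SET}.
    by move=> i; rewrite !inE negbK.
  have [U NU HU] := small_on_bounded jj ST (fun=> 0) BD MW.
  by exists U => // z zS zT; apply: HU => // i; rewrite finset.setUCr inE.
exists U => // x y Ax Ay Uxy.
(* Passing from [z m] to [z m.+1] changes the coordinate [m] by [x - y]. *)
pose z (m : nat) : 'I_k -> X := fun i => if (i < m)%N then x else y.
have -> : F (fun=> x) = F (z k).
  by congr F; apply/funext => i; rewrite /z ltn_ord.
have -> : F (fun=> y) = F (z 0%N) by congr F; apply/funext.
rewrite -(telescope_sumr (fun m => F (z m))) // big_mkord.
apply: WV => [|j _]; first by rewrite size_index_enum card_ord.
have zS : z j.+1 = dfwith (z j) j x.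
  apply/funext => i; case: dfwithP => [|i' ji]; first by rewrite /z ltnS leqnn.
  by rewrite /z ltnS leq_eqVlt eq_sym (inj_eq val_inj) (negbTE ji).
have zj : z j = dfwith (z j) j y.
  apply/funext => i; case: dfwithP => [|//]; by rewrite /z ltnn.
rewrite zS [X in _ - F X]zj -multilinearB //.
apply: (HU j) => i; rewrite !inE.
  by move=> /eqP ->; rewrite dfwithin; split => //; exact: AAD.
case: dfwithP => [|i' ji _]; first by rewrite eqxx.
by rewrite /z; case: ifP => _; exact: AD.
Qed.

End SmallMultilinear.

(** * Weakly bounded sets are totally bounded *)

Definition balls_totally_bounded (K : numFieldType) : Prop :=
  forall r e : K, 0 < e -> exists (J : finType) (g : K -> J),
    forall z w, `|z| <= r -> `|w| <= r -> g z = g w -> `|z - w| < e.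

(** Cut the interval into pieces of length [e]. *)
Lemma real_balls_totally_bounded (R : realType) : balls_totally_bounded R.
Proof.
move=> r e e0; pose h (z : R) : nat := Num.truncn ((z + r) / e).
pose n := Num.truncn ((r + r) / e).
exists 'I_n.+1, (fun z => inord (h z)) => z w zr wr.
have hP (u : R) : `|u| <= r ->
    ((h u)%:R <= (u + r) / e < (h u).+1%:R) /\ (h u <= n)%N.
  rewrite ler_norml => /andP[ur ru]; split.
    apply: Num.Theory.truncn_itv.
    by rewrite divr_ge0 ?(ltW e0) // -lerBlDr sub0r.
  by apply: le_truncn; rewrite ler_pM2r ?invr_gt0 // lerD2r.
have [/andP[z1 z2] zn] := hP _ zr; have [/andP[w1 w2] wn] := hP _ wr.
move=> /(congr1 val); rewrite /= !inordK ?ltnS // => hzw.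
rewrite hzw in z1 z2; rewrite -(ltr_pM2r (x := e^-1)) ?invr_gt0 //.
rewrite divff ?gt_eqF //.
have -> : `|z - w| / e = `|(z + r) / e - (w + r) / e|.
  rewrite -mulrBl normrM (gtr0_norm (x := e^-1)) ?invr_gt0 //.
  by rewrite opprD addrACA subrr addr0.
move: z1 z2 w1 w2; set p := (z + r) / e; set q := (w + r) / e.
rewrite -natr1 => ? ? ? ?; rewrite ltr_norml; apply/andP; split; lra.
Qed.

Lemma normc_i (R : realType) : `|'i%C : R[i]| = 1.
Proof. by rewrite normc_def /= expr0n expr1n add0r sqrtr1. Qed.

Lemma normc_le_ReIm (R : realType) (z : R[i]) :
  `|z| <= (`|complex.Re z| + `|complex.Im z|)%:C%C.
Proof.
have normcR (a : R) : `|a%:C%C| = `|a|%:C%C :> R[i].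
  by rewrite normc_def /= expr0n addr0 sqrtr_sqr.
rewrite {1}[z]complexE rmorphD (le_trans (ler_normD _ _)) // normrM !normcR.
by rewrite normc_i mul1r.
Qed.

Lemma complex_balls_totally_bounded (R : realType) :
  balls_totally_bounded R[i].
Proof.
move=> r e; rewrite ltcE /= => /andP[/eqP e_im e_re].
have [J [g gP]] :=
  real_balls_totally_bounded (complex.Re r) (divr_gt0 e_re (ltr0Sn R 1)).
have ReP (z : R[i]) : `|z| <= r -> `|complex.Re z| <= complex.Re r.
  by move=> /(le_trans (normc_ge_Re z)); rewrite lecE /= => /andP[].
have ImP (z : R[i]) : `|z| <= r -> `|complex.Im z| <= complex.Re r.
  move=> zr; rewrite -normrN -ReiNIm; apply: ReP.
  by rewrite normrM normc_i mulr1.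
exists (J * J)%type, (fun z => (g (complex.Re z), g (complex.Im z))).
move=> z w zr wr [gRe gIm].
apply: le_lt_trans (normc_le_ReIm _) _.
rewrite ltcE /= e_im eqxx /= [ltRHS]splitr.
have := gP _ _ (ReP _ zr) (ReP _ wr) gRe.
have := gP _ _ (ImP _ zr) (ImP _ wr) gIm.
by move: zr wr gRe gIm; case: z w => [a b] [c d] /= _ _ _ _ ? ?; exact: ltrD.
Qed.

Lemma weakly_bounded_functional (K : numFieldType) (X : topologicalLmodType K)
    (A : set X) (f : topological_dual X) : weakly_bounded A ->
  exists r : K, forall x, A x -> `|sval f x| <= r.
Proof.
pose S := Topological.Pack (weak_topology X).
have NU : nbhs (0 : S) [set x : X | `|sval f x| < 1].
  have := (@cvg_sup X _ (fun f : topological_dual X =>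
      Topological.on (initial_topology (sval f : X -> K^o)))
    (nbhs (0 : S)) (0 : X) (nbhs_filter (0 : S))).1 (fun _ => id) f.
  apply; apply: (@initial_continuous X K^o (sval f) (0 : X) [set y | `|y| < 1]).
  rewrite /= linear0; exact: (@nbhs0_lt K K^o 1 ltr01).
move=> /(_ _ NU)[s s0 /(_ (s + 1))]; rewrite ltrDl ltr01 => /(_ erefl) As.
exists (s + 1) => x /As[u /= fu <-].
have s1 : 0 <= s + 1 by rewrite addr_ge0 // ltW.
by rewrite linearZ normrM (ger0_norm s1) ler_piMr // ltW.
Qed.

(** The sets that contain all differences within the pieces of some finite
    partition of [A] form a filter. It converges to zero for the weak topology
    as soon as it does for each initial topology, and that is total boundedness
    of the image of [A] under one functional. *)
Lemma weakly_bounded_totally_bounded (K : numFieldType)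
    (X : topologicalLmodType K) (tau : Topological X) (A : set X) :
  balls_totally_bounded K -> coarser tau (weak_topology X) ->
  weakly_bounded A -> totally_bounded (topology_nbhs tau 0) A.
Proof.
move=> K_balls tau_weak A_bd U.
pose small : set_system X := [set U | exists (J : finType) (g : X -> J),
  forall x y, A x -> A y -> g x = g y -> U (x - y)].
have small_filter : Filter small.
  split.
  - by exists unit, (fun=> tt).
  - move=> U1 U2 [J1 [g1 HU1]] [J2 [g2 HU2]].
    exists (J1 * J2)%type, (fun x => (g1 x, g2 x)) => x y Ax Ay [? ?].
    by split; [exact: HU1|exact: HU2].
  - by move=> U1 U2 U12 [J [g HU1]]; exists J, g => x y ? ? ?; exact/U12/HU1.
pose S := Topological.Pack (weak_topology X).
have small_cvg : small --> (0 : S).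
  apply/(@cvg_sup X _ (fun f : topological_dual X =>
      Topological.on (initial_topology (sval f : X -> K^o))) small (0 : X)).
  move=> f W [_ [[G oG <-] /= G0 GW]].
  have : nbhs (0 : K^o) G.
    by apply: open_nbhs_nbhs; split; rewrite -?(linear0 (sval f)).
  move=> /nbhs_normP[e /= e0 eG].
  have [r Ar] := weakly_bounded_functional f A_bd.
  have [J [g gP]] := K_balls r e e0.
  exists J, (g \o sval f) => x y Ax Ay gxy; apply/GW/eG => /=.
  by rewrite sub0r normrN linearB; apply: gP => //; exact: Ar.
rewrite /topology_nbhs (@nbhsE (Topological.Pack tau)) => -[G [oG G0] GU].
apply: small_cvg; rewrite /= (@nbhsE S); exists G => //; split => //.
exact: tau_weak.
Qed.

(** * Uniform continuity of homogeneous polynomials *)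

Theorem corollary8 (R : realType) (K : numFieldType) (hK : real_or_complex R K)
    (X Y : topologicalLmodType K)
    (tau : Topological X) (tau_vector : vector_topology tau)
    (tau_weak : coarser tau (weak_topology X))
    (B : set_system X) (B_bornology : bornology B)
    (B_weakly_bounded : forall A : set X, B A -> weakly_bounded A)
    (k : nat) (P : X -> Y) (P_poly : homogeneous_polynomial k P) :
  continuous_on_sets tau B P <-> unif_continuous_on_sets tau B P.
Proof.
split; last first.
  move=> P_unif A BA x Ax V NV; have [U NU HU] := P_unif V NV A BA.
  by exists U => // y Ay; exact: HU.
move=> P_cont V NV A BA.
have [F [F_sym F_lin PF]] := P_poly.
have K_balls : balls_totally_bounded K.
  case: hK => ->; first exact: real_balls_totally_bounded.
  exact: complex_balls_totally_bounded.
have tauP := nbhs_additive_filter tau_vector.1.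
have YP : additive_filter (nbhs (0 : Y)).
  exact: (@nbhs_additive_filter Y (Topological.on Y) (@add_continuous Y)).
have B_tb D : B D -> totally_bounded (topology_nbhs tau 0) D.
  move=> BD; apply: weakly_bounded_totally_bounded => //.
  exact: B_weakly_bounded.
have F_cont D : B D -> forall p, D p -> forall W, nbhs (0 : Y) W ->
    exists2 U, topology_nbhs tau 0 U &
    forall y, D y -> U (y - p) -> W (F (fun=> y) - F (fun=> p)).
  move=> BD p Dp W NW; have [U NU HU] := P_cont D BD p Dp W NW.
  by exists U => // y Dy Uy; rewrite -!PF; exact: HU.
have [U NU HU] := unif_continuous_multilinear tauP YP (@nbhs0_scale K Y)
  B_bornology B_tb F_sym F_lin F_cont BA NV.
by exists U => // x y Ax Ay Uxy; rewrite !PF; exact: HU.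
Qed.
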